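(* Let $Q$ be a fork with $n$ vertices and point of return $r$, and let $\boldsymbol{w}$ be a fork-preserving mutation sequence from $Q$. Let $l_i^{\boldsymbol{w}}$ be the $l$-vectors of the GIM $A$ associated to $Q$ and the linear ordering $r\prec a_{n-1}\prec a_{n-2}\prec\dots\prec a_1$, where $a_1,\dots,a_{n-1}$ are the vertices of $Q\setminus\{r\}$ listed so that every arrow $a_s\to a_t$ has $s<t$. Then for each $i\in\{1,\dots,n\}$ there exists a diagonal matrix $D_i^{\boldsymbol{w}}$ with $(D_i^{\boldsymbol{w}})^2=1$ and $l_i^{\boldsymbol{w}}=c_i^{\boldsymbol{w}}D_i^{\boldsymbol{w}}$ (in $\mathbb Z^n/\{\pm1\}$). In other words, the entries of the $l$-vectors equal the entries of the $c$-vectors up to sign.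
   Context: A quiver on the vertex set $\{1,\dots,n\}$ (no loops, no oriented 2-cycles) is identified with an $n\times n$ skew-symmetric integer matrix $B=[b_{ij}]$: if $b_{ij}>0$ there are $b_{ij}$ arrows from $i$ to $j$. Mutation: for an $n\times 2n$ integer matrix $M=[m_{ij}]$ and $k\in\{1,\dots,n\}$, the mutation of $M$ at $k$ is the matrix with entries $-m_{ij}$ if $i=k$ or $j=k$, and $m_{ij}+\mathrm{sgn}(m_{ik})\max(m_{ik}m_{kj},0)$ otherwise. A mutation sequence $\boldsymbol{w}=[i_1,\dots,i_\ell]$ (possibly empty) means mutating at $i_1$, then $i_2$, etc.; $\boldsymbol{w}[k]$ is $\boldsymbol{w}$ followed by $k$; $\boldsymbol{w}$ is reduced if $i_j\ne i_{j+1}$ for all $j$. Starting from $[B\mid I]$, the result after $\boldsymbol{w}$ is written $[B^{\boldsymbol{w}}\mid C^{\boldsymbol{w}}]$ with $B^{\boldsymbol{w}}=[b_{ij}^{\boldsymbol{w}}]$; the rows $c_i^{\boldsymbol{w}}$ of $C^{\boldsymbol{w}}$ are the $c$-vectors (known to be nonzero, with all nonzero entries of one sign). For a nonzero vector $c$, $c>0$ means all entries are $\ge0$. A quiver is abundant if there are at least two arrows between every pair of distinct vertices. A fork is an abundant, non-acyclic quiver $F=[f_{ij}]$ with a vertex $r$ (the point of return, which is unique) such that, with $F^-(r)$ the set of vertices having arrows to $r$ and $F^+(r)$ the set of vertices receiving arrows from $r$: for all $i\in F^-(r)$, $j\in F^+(r)$ one has $f_{ji}>f_{ir}$ and $f_{ji}>f_{rj}$;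 and the full subquivers on $F^-(r)$ and on $F^+(r)$ are acyclic. Then $F\setminus\{r\}$ is acyclic. A fork-preserving mutation sequence from a fork with point of return $r$ is a reduced mutation sequence whose first mutation (if any) is not at $r$. The GIM associated to $B$ and a linear ordering $\prec$ on $\{1,\dots,n\}$ is the symmetric matrix $A=[a_{ij}]$ with $a_{ij}=b_{ij}$ if $i\prec j$, $a_{ii}=2$, $a_{ij}=-b_{ij}$ if $i\succ j$. Reflections and $l$-vectors: $\mathcal W=\langle s_1,\dots,s_n\mid s_i^2=1\rangle$ acts on $\Gamma=\bigoplus_i\mathbb Z\alpha_i=\mathbb Z^n$ ($\alpha_i$ the standard basis) by $s_i(\alpha_j)=\alpha_j-a_{ji}\alpha_i$. Set $\mathbf{r}_i^{[\,]}=s_i$ and inductively $\mathbf{r}_i^{\boldsymbol{w}[k]}=\mathbf{r}_k^{\boldsymbol{w}}\mathbf{r}_i^{\boldsymbol{w}}\mathbf{r}_k^{\boldsymbol{w}}$ if $b_{ik}^{\boldsymbol{w}}c_k^{\boldsymbol{w}}>0$, and $\mathbf{r}_i^{\boldsymbol{w}[k]}=\mathbf{r}_i^{\boldsymbol{w}}$ otherwise. Each $\mathbf{r}_i^{\boldsymbol{w}}$ has the form $g_i^{\boldsymbol{w}}s_i(g_i^{\boldsymbol{w}})^{-1}$ with $g_i^{\boldsymbol{w}}\in\mathcal W$, and $l_i^{\boldsymbol{w}}:=g_i^{\boldsymbol{w}}(\alpha_i)\in\mathbb Z^n/\{\pm1\}$, a row vector well defined up to overall sign. *)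

(* Defs.v *)
From HB Require Import structures.
From mathcomp Require Import all_boot all_order all_algebra.
From mathcomp Require Import ring.

Set Implicit Arguments.
Unset Strict Implicit.
Unset Printing Implicit Defensive.

Import Order.TTheory GRing.Theory Num.Theory.
Local Open Scope ring_scope.

(* Vertices 1, ..., n are the elements of 'I_n. *)

Section Quivers.
Variable n : nat.
Implicit Types (B : 'M[int]_n) (i j k r : 'I_n) (S : {set 'I_n}).

Definition quiver B := B^T = - B.

Definition arrow B : rel 'I_n := fun i j => 0 < B i j.

(* [cycle e [::]] holds in MathComp, hence the nonemptiness condition. *)
Definition acyclic_on B S :=
  forall p : seq 'I_n,
    p != [::] -> {subset p <= S} -> ~~ cycle (arrow B) p.

Definition acyclic B := acyclic_on B [set: 'I_n].

Definition abundant B := forall i j, i != j -> 2 <= `|B i j|.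

Definition in_nbrs B r := [set i | arrow B i r].
Definition out_nbrs B r := [set j | arrow B r j].

Definition fork B r :=
  [/\ quiver B, abundant B, ~ acyclic B,
      forall i j, i \in in_nbrs B r -> j \in out_nbrs B r ->
        B i r < B j i /\ B r j < B j i
    & acyclic_on B (in_nbrs B r) /\ acyclic_on B (out_nbrs B r)].

Definition reduced (w : seq 'I_n) := sorted (fun i j => i != j) w.

Definition fork_preserving r (w : seq 'I_n) :=
  reduced w && (ohead w != Some r).

(* [a = [:: a_1; ...; a_(n-1)]] lists the vertices other than [r], each once,
   and every arrow a_s -> a_t has s < t. *)
Definition acyclic_listing B r (a : seq 'I_n) :=
  perm_eq (r :: a) (enum 'I_n) /\
  {in a &, forall x y, arrow B x y -> (index x a < index y a)%N}.

End Quivers.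

Section Mutation.
Variable n : nat.
Implicit Types (B : 'M[int]_n) (M : 'M[int]_(n, n + n)) (i k : 'I_n).

Definition mutate M k : 'M[int]_(n, n + n) :=
  \matrix_(i, j)
    if (i == k) || (j == lshift n k) then - M i j
    else M i j
         + Num.sg (M i (lshift n k)) * Num.max (M i (lshift n k) * M k j) 0.

Definition framed B : 'M[int]_(n, n + n) := row_mx B 1%:M.

Definition mutation_seq M (w : seq 'I_n) := foldl mutate M w.

Definition Bmat B w : 'M[int]_n := lsubmx (mutation_seq (framed B) w).
Definition Cmat B w : 'M[int]_n := rsubmx (mutation_seq (framed B) w).
Definition cvec B w i : 'rV[int]_n := row i (Cmat B w).

Definition vpos (v : 'rV[int]_n) := (v != 0) && [forall j, 0 <= v 0 j].

End Mutation.

(* The group W = < s_1, ..., s_n | s_i^2 = 1 >.  Its elements are represented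
   by words in the generators, [i] standing for s_i; [eqW] is equality in W,
   i.e. the congruence on words generated by the relations s_i s_i = 1.
   Products are concatenations, and inverses are reversals ([eqW_revK]). *)
Inductive eqW n : seq 'I_n -> seq 'I_n -> Prop :=
| eqW_cancel (u v : seq 'I_n) (i : 'I_n) : eqW (u ++ [:: i; i] ++ v) (u ++ v)
| eqW_refl (u : seq 'I_n) : eqW u u
| eqW_sym (u v : seq 'I_n) : eqW u v -> eqW v u
| eqW_trans (u v w : seq 'I_n) : eqW u v -> eqW v w -> eqW u w.

Section Reflections.
Variable n : nat.
Implicit Types (A B : 'M[int]_n) (g u v w : seq 'I_n) (i k : 'I_n).
Implicit Types (x y l : 'rV[int]_n).

Definition conjW g i : seq 'I_n := g ++ [:: i] ++ rev g.

(* [refl_rev B v i] is the element r_i^w of W for [w = rev v]: recursion on the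
   last mutation of [w]; see [refl_nil] and [refl_rcons]. *)
Fixpoint refl_rev B (v : seq 'I_n) (i : 'I_n) : seq 'I_n :=
  if v is k :: v' then
    let w := rev v' in
    if vpos (Bmat B w i k *: cvec B w k)
    then refl_rev B v' k ++ refl_rev B v' i ++ refl_rev B v' k
    else refl_rev B v' i
  else [:: i].

Definition refl B w i := refl_rev B (rev w) i.

(* The linear order in which the vertices occur in a list. *)
Definition list_order (s : seq 'I_n) : rel 'I_n :=
  fun i j => (index i s < index j s)%N.

Definition gim B (prec : rel 'I_n) : 'M[int]_n :=
  \matrix_(i, j) if i == j then 2 else if prec i j then B i j else - B i j.

Definition alpha i : 'rV[int]_n := delta_mx 0 i.

(* The linear extension of s_i(alpha_j) = alpha_j - a_ji alpha_i
   ([act_gen_alpha]): the coefficient of alpha_i is \sum_j x_j a_ji. *)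
Definition act_gen A i x : 'rV[int]_n := x - (x *m A) 0 i *: alpha i.

Definition act A g x : 'rV[int]_n := foldr (act_gen A) x g.

(* The class l_i^w in Z^n / {1, -1}, as the set of its representatives:
   the vectors g(alpha_i) for g in W such that r_i^w = g s_i g^-1.
   It is nonempty ([lvector_exists]) and is a single class modulo sign
   ([lvector_uniq]). *)
Definition lvector A B w i l :=
  exists2 g, eqW (refl B w i) (conjW g i) & l = act A g (alpha i).

Definition eq_upto_sign x y := x = y \/ x = - y.

Lemma refl_nil B i : refl B [::] i = [:: i].
Proof. by []. Qed.

Lemma refl_rcons B w k i :
  refl B (rcons w k) i =
    if vpos (Bmat B w i k *: cvec B w k)
    then refl B w k ++ refl B w i ++ refl B w k else refl B w i.
Proof. by rewrite /refl rev_rcons /= revK. Qed.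

Lemma eqW_catl g u v : eqW u v -> eqW (g ++ u) (g ++ v).
Proof.
elim=> [u' v' i|u'|u' v' _ IH|u' v' w' _ IH1 _ IH2].
- by rewrite !(catA g u'); apply: eqW_cancel.
- exact: eqW_refl.
- exact: eqW_sym.
- exact: eqW_trans IH1 IH2.
Qed.

Lemma eqW_catr g u v : eqW u v -> eqW (u ++ g) (v ++ g).
Proof.
elim=> [u' v' i|u'|u' v' _ IH|u' v' w' _ IH1 _ IH2].
- by rewrite -!catA; apply: eqW_cancel.
- exact: eqW_refl.
- exact: eqW_sym.
- exact: eqW_trans IH1 IH2.
Qed.

Lemma eqW_cat u u' v v' : eqW u u' -> eqW v v' -> eqW (u ++ v) (u' ++ v').
Proof.
by move=> Hu Hv; apply: eqW_trans (eqW_catr v Hu) (eqW_catl u' Hv).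
Qed.

Lemma eqW_revK g : eqW (rev g ++ g) [::].
Proof.
elim: g => [|i g IH]; first exact: eqW_refl.
rewrite rev_cons cat_rcons.
exact: eqW_trans (eqW_cancel (rev g) g i) IH.
Qed.

Lemma conjW_rev g i : rev (conjW g i) = conjW g i.
Proof. by rewrite /conjW !rev_cat revK -catA. Qed.

Lemma refl_conj B w i : exists g, eqW (refl B w i) (conjW g i).
Proof.
elim/last_ind: w i => [|w k IH] i; first by exists [::]; apply: eqW_refl.
rewrite refl_rcons; case: ifP => _; last exact: IH.
have [g Hg] := IH i; have [h Hh] := IH k.
exists (conjW h k ++ g).
rewrite {1}/conjW rev_cat conjW_rev.
have -> : (conjW h k ++ g) ++ [:: i] ++ rev g ++ conjW h k
        = conjW h k ++ conjW g i ++ conjW h k by rewrite /conjW -!catA.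
by apply: eqW_cat => //; apply: eqW_cat.
Qed.

Lemma lvector_exists A B w i : exists l, lvector A B w i l.
Proof.
by have [g Hg] := refl_conj B w i; exists (act A g (alpha i)); exists g.
Qed.

Lemma act_cat A u v x : act A (u ++ v) x = act A u (act A v x).
Proof. by rewrite /act foldr_cat. Qed.

Lemma act_gen_alpha A i k : act_gen A i (alpha k) = alpha k - A k i *: alpha i.
Proof. by rewrite /act_gen /alpha -rowE mxE. Qed.

Lemma act_genZ A i c x : act_gen A i (c *: x) = c *: act_gen A i x.
Proof. by rewrite /act_gen -scalemxAl mxE scalerBr scalerA. Qed.

Lemma actZ A g c x : act A g (c *: x) = c *: act A g x.
Proof. by elim: g => //= i g ->; rewrite act_genZ. Qed.

Lemma actN A g x : act A g (- x) = - act A g x.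
Proof. by rewrite -[- x]scaleN1r actZ scaleN1r. Qed.

Section Diag2.
Variable A : 'M[int]_n.
Hypothesis A2 : forall i, A i i = 2.

Lemma act_genK i x : act_gen A i (act_gen A i x) = x.
Proof.
rewrite {1}/act_gen {1 2}/act_gen mulmxBl -scalemxAl /alpha -rowE !mxE A2.
apply/rowP => j; rewrite !mxE; ring.
Qed.

Lemma act_eqW u v x : eqW u v -> act A u x = act A v x.
Proof.
elim=> [u' v' i|//|//|u' v' w' _ -> _ -> //].
by rewrite !act_cat /= act_genK.
Qed.

Lemma act_revK g x : act A (rev g) (act A g x) = x.
Proof. by rewrite -act_cat (act_eqW x (eqW_revK g)). Qed.

Lemma act_conj_alpha g i :
  act A (conjW g i) (act A g (alpha i)) = - act A g (alpha i).
Proof.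
rewrite /conjW !act_cat act_revK /= act_gen_alpha A2.
by rewrite -actN; congr act; apply/rowP => j; rewrite !mxE; ring.
Qed.

Lemma eigen_alpha i x : act_gen A i x = - x -> x = x 0 i *: alpha i.
Proof.
move=> /rowP H; apply/rowP => j; move: (H j).
rewrite !mxE !eqxx /=; case: eqP => [->|_] /=; first by rewrite !mulr1.
rewrite !mulr0 subr0 => /eqP; rewrite -addr_eq0 -mulr2n mulrn_eq0 /=.
by move/eqP.
Qed.

Lemma lvector_colinear B w i l l' :
  lvector A B w i l -> lvector A B w i l' -> exists c, l' = c *: l.
Proof.
move=> [g Hg ->] [h Hh ->].
set y := act A h _; exists (act A (rev g) y 0 i).
rewrite -actZ -eigen_alpha.
  by rewrite -{1}(revK g) act_revK.
have E : act A (conjW g i) y = - y.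
  by rewrite -(act_eqW _ Hg) (act_eqW _ Hh); exact: act_conj_alpha.
rewrite -actN -E /conjW !act_cat.
by rewrite act_revK.
Qed.

Lemma lvector_uniq B w i l l' :
  lvector A B w i l -> (lvector A B w i l' <-> eq_upto_sign l' l).
Proof.
move=> Hl; split=> [Hl'|].
  have [c Ec] := lvector_colinear Hl Hl'.
  have [d Ed] := lvector_colinear Hl' Hl.
  have nzl : l != 0.
    case: (Hl) => g _ ->; apply/eqP => /(congr1 (act A (rev g))).
    rewrite act_revK -(scale0r (0 : 'rV[int]_n)) actZ scale0r => /rowP/(_ i).
    by rewrite !mxE !eqxx.
  have dc1 : d * c = 1.
    move: nzl; rewrite {1}Ed Ec scalerA => nz.
    have [j nzj] : exists j, l 0 j != 0 by apply/rV0Pn; rewrite Ed Ec scalerA.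
    apply: (mulIf nzj); rewrite mul1r.
    by move/rowP/(_ j): Ed; rewrite Ec scalerA mxE.
  have : c \is a GRing.unit by apply/unitrPr; exists d; rewrite mulrC.
  rewrite qualifE /= => /orP[]/eqP cE; move: Ec; rewrite cE.
    by rewrite scale1r; left.
  by rewrite scaleN1r; right.
case=> ->; first by [].
case: Hl => g Hg ->; exists (g ++ [:: i]); last first.
  rewrite act_cat /= act_gen_alpha A2 -actN; congr act.
  by apply/rowP => j; rewrite !mxE; ring.
apply: eqW_trans Hg _; apply: eqW_sym; rewrite /conjW rev_cat -!catA.
exact/eqW_catl/(eqW_cancel [::]).
Qed.

End Diag2.

Lemma gim_diag B prec i : gim B prec i i = 2.
Proof. by rewrite mxE eqxx. Qed.

End Reflections.

(* Main.v *)
(** A mutation of a fork away from its point of return [r] is a fork with point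
    of return the mutated vertex [k], and along fork-preserving sequences one
    can follow the signs [s_i] of the c-vectors together with the Gram matrix
    of the vectors [c_i D], for one fixed sign matrix [D], in the form of the
    GIM: off the point of return it is [- s_i s_j |b_ij|], and its row at [r]
    is [- s_i b_ri].  Hence whenever [c_i] changes into [c_i + |b_ik| c_k],
    the reflection in [c_k D] changes [c_i D] into [(c_i + |b_ik| c_k) D], and
    [l_i = c_i D] persists.  The matrix [D] depends only on the first mutation
    [k]: it negates the coordinate [r] if [r -> k], and is [1] otherwise. *)

Require Import Defs.
From mathcomp Require Import all_boot all_order all_algebra.
From mathcomp Require Import zify ring.

Set Implicit Arguments.
Unset Strict Implicit.
Unset Printing Implicit Defensive.

Import Order.TTheory GRing.Theory Num.Theory.
Local Open Scope ring_scope.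

(** * Mutation of the two blocks [B] and [C], entry by entry and row by row *)

Section MutationEntries.
Variable n : nat.
Implicit Types (B C : 'M[int]_n) (i j k m : 'I_n) (w : seq 'I_n).

Definition mutB B k : 'M[int]_n :=
  \matrix_(i, j)
    if (i == k) || (j == k) then - B i j
    else B i j + Num.sg (B i k) * Num.max (B i k * B k j) 0.

Definition mutC B C k : 'M[int]_n :=
  \matrix_(i, m)
    if i == k then - C i m
    else C i m + Num.sg (B i k) * Num.max (B i k * C k m) 0.

Lemma Bmat_nil B : Bmat B [::] = B.
Proof. exact: row_mxKl. Qed.

Lemma Cmat_nil B : Cmat B [::] = 1%:M.
Proof. exact: row_mxKr. Qed.

Lemma Bmat_rcons B w k : Bmat B (rcons w k) = mutB (Bmat B w) k.
Proof.
by apply/matrixP=> i j; rewrite /Bmat /mutation_seq foldl_rcons !mxE eq_shift.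
Qed.

Lemma Cmat_rcons B w k : Cmat B (rcons w k) = mutC (Bmat B w) (Cmat B w) k.
Proof.
apply/matrixP=> i j; rewrite /Bmat /Cmat /mutation_seq foldl_rcons !mxE.
by rewrite eq_shift orbF.
Qed.

Lemma mutBN B k : mutB (- B) k = - mutB B k.
Proof.
apply/matrixP=> i j; rewrite !mxE; case: ifP => // _.
by rewrite mulrNN sgrN mulNr opprD.
Qed.

Lemma mutCN B C k : mutC (- B) (- C) k = - mutC B C k.
Proof.
apply/matrixP=> i j; rewrite !mxE; case: ifP => // _.
by rewrite mulrNN sgrN mulNr opprD.
Qed.

End MutationEntries.

Lemma sgr_max_mul (x y : int) :
  Num.sg x * Num.max (x * y) 0 = if 0 < x * y then `|x| * y else 0.
Proof.
rewrite maxC /Num.max; case: ifP => _; last exact: mulr0.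
by rewrite mulrA -normrEsg.
Qed.

(** Since row [k] has a single sign [s], the sign of [B i k * s] decides all the entrywise maxima at
    once, and zero entries of row [k] contribute nothing either way. *)
Lemma row_mutC n (B C : 'M[int]_n) i k (s : int) :
  s = 1 \/ s = -1 -> (forall m, 0 <= s * C k m) -> i != k ->
  row i (mutC B C k) =
    row i C + (if 0 < B i k * s then `|B i k| else 0) *: row k C.
Proof.
move=> s1 c0 ik; apply/rowP=> m; rewrite !mxE (negPf ik) sgr_max_mul.
congr (_ + _); have := c0 m.
by case: s1 => ->; do 2 (case: ifP => [|/negP]); nia.
Qed.

(** * The bilinear form of a matrix [A] *)

Section Form.
Variables (n : nat) (A : 'M[int]_n).
Implicit Types (x y z : 'rV[int]_n).

Definition form x y : int := (x *m A *m y^T) 0 0.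

Lemma formDl x y z : form (x + y) z = form x z + form y z.
Proof. by rewrite /form !mulmxDl mxE. Qed.
Lemma formDr x y z : form z (x + y) = form z x + form z y.
Proof. by rewrite /form linearD mulmxDr mxE. Qed.
Lemma formZl c x z : form (c *: x) z = c * form x z.
Proof. by rewrite /form -!scalemxAl mxE. Qed.
Lemma formZr c x z : form z (c *: x) = c * form z x.
Proof. by rewrite /form linearZ -scalemxAr mxE. Qed.
Lemma formNl x z : form (- x) z = - form x z.
Proof. by rewrite -scaleN1r formZl mulN1r. Qed.
Lemma formNr x z : form z (- x) = - form z x.
Proof. by rewrite -scaleN1r formZr mulN1r. Qed.
Lemma formC x y : A^T = A -> form x y = form y x.
Proof.
move=> sA; rewrite /form; transitivity ((y *m A *m x^T)^T 0 0).
  by rewrite !trmx_mul trmxK sA mulmxA.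
by rewrite mxE.
Qed.
Lemma form_alphar x i : form x (alpha i) = (x *m A) 0 i.
Proof. by rewrite /form /alpha trmx_delta -colE mxE. Qed.
Lemma form_alpha i j : form (alpha i) (alpha j) = A i j.
Proof. by rewrite form_alphar /alpha -rowE mxE. Qed.
End Form.

(** * Invariants of forks and of sign-coherent c-vectors *)

Section Step.
Variable n : nat.
Implicit Types (A B C : 'M[int]_n) (s : 'I_n -> int) (i j k l m r : 'I_n).

(** In an abundant quiver any two vertices are joined by arrows, so acyclicity away from [r] can be
    recorded as transitivity of the arrows. *)
Record ordered_fork B r : Prop := OrderedFork {
  of_skew : forall i j, B i j = - B j i;
  of_abundant : forall i j, i != j -> 2 <= `|B i j|;
  of_trans : forall i j l, i != r -> j != r -> l != r ->
    0 < B i j -> 0 < B j l -> 0 < B i l;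
  of_return : forall i j, 0 < B i r -> 0 < B r j ->
    B i r < B j i /\ B r j < B j i }.

(* [s i] is the sign of the c-vector [row i C].  By [co_sorted], a mutation at
   [j] moves, [r] apart, only vertices of the same sign as [j]; [r] itself may
   change sign, and stays sign-coherent because [j] then dominates [r]. *)
Record coherent A B C s r : Prop := Coherent {
  co_sign : forall i, s i = 1 \/ s i = -1;
  co_sorted : forall i j, i != r -> j != r -> 0 < B i j * s j -> s i = s j;
  co_ge0 : forall i m, 0 <= s i * C i m;
  co_gram2 : forall i, form A (row i C) (row i C) = 2;
  co_gram : forall i j, i != r -> j != r -> i != j ->
    form A (row i C) (row j C) = - s i * s j * `|B i j|;
  co_gramr : forall i, i != r -> form A (row r C) (row i C) = - s i * B r i }.

(** In this case the mutation at [i] moves [r], whose c-vector has the opposite sign; the bound lets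
    the sign of [i] win in every entry. *)
Definition dominating B C s r i :=
  B r i * s r < 0 -> s i = - s r /\ forall m, s r * C r m <= s i * C i m.

Definition mut_sign B s k i :=
  if i == k then - s k else if 0 < B i k * s k then s k else s i.

Lemma ordered_forkN B r : ordered_fork B r -> ordered_fork (- B) r.
Proof.
case=> sk ab tr re; split=> [i j|i j ij|i j l ir jr lr|i j]; rewrite !mxE.
- by rewrite sk.
- by rewrite normrN ab.
- rewrite -!sk => h1 h2; exact: tr h2 h1.
- rewrite -!sk => h1 h2; have := re _ _ h2 h1; lia.
Qed.

(** Negating [B], [C] and the signs commutes with mutation, by [mutBN] and [mutCN]; this reduces
    mutations at a vertex of sign -1 to sign 1. *)
Lemma coherentN A B C s r :
  coherent A B C s r -> coherent A (- B) (- C) (fun i => - s i) r.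
Proof.
case=> s1 so p g2 g gr; split=> [i|i j ir jr|i m|i|i j ir jr ij|i ir].
- by case: (s1 i) => ->; [right|left; rewrite opprK].
- by rewrite mxE mulrNN => /so ->.
- by rewrite mxE mulrNN.
- by rewrite !raddfN /= formNl formNr opprK.
- by rewrite !raddfN /= formNl formNr opprK g // mxE normrN; ring.
- by rewrite !raddfN /= formNl formNr opprK gr // mxE; ring.
Qed.

Lemma dominatingN B C s r i :
  dominating B C s r i -> dominating (- B) (- C) (fun i => - s i) r i.
Proof.
move=> d; rewrite /dominating mxE mulrNN => /d[-> h]; split=> // m.
by rewrite !mxE !mulrNN.
Qed.

(** * Mutation of a fork away from its point of return *)

Section Entries.
Variables (B : 'M[int]_n) (r k : 'I_n).
Hypothesis fB : ordered_fork B r.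

Lemma skew_diag i : B i i = 0.
Proof. have := of_skew fB i i; lia. Qed.

Lemma arrow_total i j : i != j -> 2 <= B i j \/ 2 <= B j i.
Proof. move=> /(of_abundant fB); have := of_skew fB i j; lia. Qed.

Lemma mutB_l j : mutB B k k j = - B k j.
Proof. by rewrite mxE eqxx. Qed.

Lemma mutB_r i : mutB B k i k = - B i k.
Proof. by rewrite mxE eqxx orbT. Qed.

Lemma mutB_through i j : 0 < B i k -> 0 < B k j ->
  mutB B k i j = B i j + B i k * B k j.
Proof.
move=> ik kj; rewrite mxE sgr_max_mul mulr_gt0 // gtr0_norm //.
have -> : (i == k) = false by apply/eqP=> e; rewrite e skew_diag in ik.
by have -> : (j == k) = false by apply/eqP=> e; rewrite e skew_diag in kj.
Qed.

Lemma mutB_skew i j : mutB B k i j = - mutB B k j i.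
Proof.
rewrite !mxE orbC; case: ifP => _; first by rewrite (of_skew fB i j).
rewrite !sgr_max_mul (of_skew fB j k) (of_skew fB k i) mulrNN normrN.
rewrite (mulrC (B k j)).
rewrite (of_skew fB j i).
case: ifP => [|_]; last by rewrite !addr0 opprK.
have [h|h] := ltP 0 (B i k); have [h'|h'] := ltP 0 (B k j); nia.
Qed.

Lemma mutB_same i j : i != k -> j != k -> (0 < B i k) = (0 < B j k) ->
  mutB B k i j = B i j.
Proof.
move=> ik jk e; rewrite mxE (negPf ik) (negPf jk) /= sgr_max_mul.
rewrite (of_skew fB k j) mulrN.
have := arrow_total ik; have := arrow_total jk.
have := of_skew fB k j; have := of_skew fB k i.
move=> *; case: ifP => //; nia.
Qed.

(** Arrows [i -> r -> k] would force [k -> i] by the return condition. So [r] is a source among the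
    in-neighbours of [k], and dually a sink among its out-neighbours. *)
Lemma return_source i : i != r -> 0 < B r k -> 0 < B i k -> 0 < B r i.
Proof.
move=> ir rk hik; have [//|h] := ltP 0 (B r i).
have h' : 0 < B i r by have := arrow_total ir; lia.
have := of_return fB h' rk; have := of_skew fB k i; lia.
Qed.

Lemma return_sink i : i != r -> 0 < B k r -> 0 < B k i -> 0 < B i r.
Proof.
move=> ir rk hik; have [//|h] := ltP 0 (B i r).
have h' : 0 < B r i by have := arrow_total ir; lia.
have := of_return fB rk h'; have := of_skew fB k i; lia.
Qed.

Hypothesis kr : k != r.

(* This is what makes [k] the new point of return. *)
Lemma mutB_return i j : 0 < B i k -> 0 < B k j ->
  B i k < mutB B k i j /\ B k j < mutB B k i j.
Proof.
move=> ik kj; rewrite mutB_through //.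
have ik' : i != k by apply/eqP=> e; rewrite e skew_diag in ik.
have jk' : j != k by apply/eqP=> e; rewrite e skew_diag in kj.
have i2 : 2 <= B i k by have := arrow_total ik'; have := of_skew fB k i; lia.
have j2 : 2 <= B k j by have := arrow_total jk'; have := of_skew fB k j; lia.
have [hij|hij] := ltP 0 (B i j); first by nia.
have ij : i != j.
  by apply/eqP=> e; rewrite e in ik; have := of_skew fB k j; lia.
have ji : 0 < B j i by have := arrow_total ij; have := of_skew fB j i; lia.
have sij := of_skew fB i j.
(* The arrows [i -> k -> j -> i] form a cycle, which must pass through [r], so [r] is [i] or [j].
   The return condition then makes the side opposite [r] the strictly heaviest of the three, and
   abundance bounds the product of weights from below. *)
have [ir|ir] := eqVneq i r.
  have := of_return fB (i := j) (j := k); rewrite -ir => /(_ ji ik); nia.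
have [jr|jr] := eqVneq j r.
  have := of_return fB (i := k) (j := i); rewrite -jr => /(_ kj ji); nia.
have := of_trans fB ir kr jr ik kj; lia.
Qed.

(** After the mutation all arrows between in-neighbours and out-neighbours of [k] go from the former
    to the latter ([pp]), while each of the two sides keeps its arrows. Each side is transitive,
    since [r] is a source or a sink in the side that contains it. *)
Lemma ordered_fork_mut : ordered_fork (mutB B k) k.
Proof.
have sk := of_skew fB.
have pp i j : i != k -> j != k -> ~~ (0 < B i k) -> 0 < B j k ->
    mutB B k i j < 0 /\ mutB B k i j <= -2.
  move=> ik jk hi hj; rewrite mutB_skew.
  have h : 0 < B k i by have := arrow_total ik; have := sk k i; lia.
  have := mutB_return hj h; lia.
split.
- exact: mutB_skew.
- move=> i j; have [->|ik] := eqVneq i k => ij.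
    by rewrite mutB_l normrN (of_abundant fB).
  have [jk|jk] := eqVneq j k.
    by rewrite jk mutB_r normrN (of_abundant fB).
  case hi: (0 < B i k); case hj: (0 < B j k).
  + by rewrite mutB_same ?hi ?hj // (of_abundant fB).
  + rewrite mutB_skew; have := pp j i jk ik; rewrite hi hj; lia.
  + have := pp i j ik jk; rewrite hi hj; lia.
  + by rewrite mutB_same ?hi ?hj // (of_abundant fB).
- move=> i j l ik jk lk hij hjl.
  case hi: (0 < B i k); case hl: (0 < B l k).
  + have hj : 0 < B j k.
      by apply/negPn/negP=> hj; have := pp j l jk lk hj hl; lia.
    move: hij hjl; rewrite !mutB_same ?hi ?hj ?hl // => hij hjl.
    have [ir|ir] := eqVneq i r.
      rewrite ir in hi hij *; apply: return_source => //.
      by apply/eqP=> e; rewrite e in hjl; have := sk r j; lia.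
    have [jr|jr] := eqVneq j r.
      rewrite jr in hj hij; have := return_source ir hj hi.
      by have := sk i r; lia.
    have [lr|lr] := eqVneq l r; last exact: (of_trans fB ir jr lr hij hjl).
    rewrite lr in hl hjl; have := return_source jr hl hj.
    by have := sk j r; lia.
  + have h : 0 < B k l by have := arrow_total lk; have := sk k l; lia.
    by have := mutB_return hi h; lia.
  + case hj: (0 < B j k).
      by have := pp i j ik jk; rewrite hi hj; lia.
    by have := pp j l jk lk; rewrite hl hj; lia.
  + have hj : (0 < B j k) = false.
      by apply/negP=> hj; have := pp i j ik jk; rewrite hi; lia.
    move: hij hjl; rewrite !mutB_same ?hi ?hj ?hl // => hij hjl.
    have out x : x != k -> (0 < B x k) = false -> 0 < B k x.
      by move=> xk; have := arrow_total xk; have := sk k x; lia.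
    have oi := out _ ik hi; have oj := out _ jk hj; have ol := out _ lk hl.
    have [lr|lr] := eqVneq l r.
      rewrite lr in ol hjl *; apply: return_sink => //.
      by apply/eqP=> e; rewrite e in hij; have := sk r j; lia.
    have [jr|jr] := eqVneq j r.
      rewrite jr in oj hjl; have := return_sink lr oj ol.
      by have := sk l r; lia.
    have [ir|ir] := eqVneq i r; last exact: (of_trans fB ir jr lr hij hjl).
    rewrite ir in oi hij; have := return_sink jr oi oj.
    by have := sk j r; lia.
- move=> i j; rewrite mutB_l mutB_r => h1 h2.
  have := @mutB_return j i; have := sk i k; have := sk k j; lia.
Qed.
End Entries.

(** * Mutation at a vertex with positive c-vector *)

Section PositiveStep.
Variables (A B C : 'M[int]_n) (s : 'I_n -> int) (r k : 'I_n).
Hypotheses (fB : ordered_fork B r) (cB : coherent A B C s r).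
Hypotheses (kr : k != r) (dk : dominating B C s r k) (symA : A^T = A).

(** As [row k C] has norm 2, this value makes the reflection in it add [|B i k|] times [row k C] to
    [row i C], just as the mutation does. *)
Lemma gram_moved i : 0 < B i k * s k ->
  form A (row i C) (row k C) = - `|B i k|.
Proof.
have skew := of_skew fB.
move=> hi; have ik : i != k.
  by apply/eqP=> e; rewrite e (skew_diag fB) mul0r in hi.
have [ir|ir] := eqVneq i r.
  rewrite ir (co_gramr cB) //; rewrite ir in hi.
  by case: (co_sign cB k) hi => -> *; lia.
rewrite (co_gram cB) // (co_sorted cB ir kr hi).
by case: (co_sign cB k) => ->; ring.
Qed.

Hypothesis sk : s k = 1.

Lemma ge0_k m : 0 <= C k m.
Proof. by have := co_ge0 cB k m; rewrite sk mul1r. Qed.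

Lemma row_mutC_fixed i : i != k -> B i k <= 0 -> row i (mutC B C k) = row i C.
Proof.
move=> ik hi; rewrite (row_mutC B (co_sign cB k) (co_ge0 cB k)) // sk mulr1.
by rewrite ltNge hi scale0r addr0.
Qed.

Lemma row_mutC_moved i : i != k -> 0 < B i k ->
  row i (mutC B C k) = row i C + B i k *: row k C.
Proof.
move=> ik hi; rewrite (row_mutC B (co_sign cB k) (co_ge0 cB k)) // sk mulr1.
by rewrite hi gtr0_norm.
Qed.

Lemma row_mutC_k : row k (mutC B C k) = - row k C.
Proof. by apply/rowP=> m; rewrite !mxE eqxx. Qed.

Lemma sign_moved i : i != k -> 0 < B i k -> mut_sign B s k i = 1.
Proof. by move=> ik hi; rewrite /mut_sign (negPf ik) sk mulr1 hi. Qed.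

Lemma sign_fixed i : i != k -> B i k <= 0 -> mut_sign B s k i = s i.
Proof. by move=> ik hi; rewrite /mut_sign (negPf ik) sk mulr1 ltNge hi. Qed.

(** If [r] were positive, domination would give [k] the sign -1. *)
Lemma sign_return : B r k <= 0 -> s r = -1.
Proof.
move=> hr; have [sr|//] := co_sign cB r.
have rk := arrow_total fB kr; have skew := of_skew fB k r.
have : B r k * s r < 0 by rewrite sr; lia.
by case/dk; lia.
Qed.

Lemma gram_fixed j : j != k -> B j k <= 0 ->
  form A (row j C) (row k C) = - s j * B k j.
Proof.
have skew := of_skew fB.
move=> jk hj; have [jr|jr] := eqVneq j r.
  rewrite jr in hj *; rewrite (co_gramr cB) // sk sign_return // (skew r k).
  by ring.
rewrite (co_gram cB) // sk; have := skew j k.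
by rewrite ler0_norm // => ->; ring.
Qed.

(** Away from [r], transitivity along [i -> k -> j] removes the absolute value. The signed form adds
    up with [gram_fixed] to [- s j * (B i j + B i k * B k j)], which contains the mutated entry. *)
Lemma gram_mixed i j : i != k -> j != k -> 0 < B i k -> B j k <= 0 ->
  form A (row i C) (row j C) = - s j * B i j.
Proof.
have skew := of_skew fB.
move=> ik jk hi hj.
have ij : i != j by apply/eqP=> e; rewrite e in hi; lia.
have [ir|ir] := eqVneq i r.
  by rewrite ir in ij *; rewrite (co_gramr cB) // eq_sym.
have [jr|jr] := eqVneq j r.
  rewrite jr in hj *; rewrite formC // (co_gramr cB) // sign_return //.
  have si : s i = 1 by rewrite (co_sorted cB ir kr) // sk mulr1.
  by rewrite si (skew i r); ring.
have si : s i = 1 by rewrite (co_sorted cB ir kr) // sk mulr1.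
have kj : 0 < B k j by have := arrow_total fB jk; have := skew k j; lia.
rewrite (co_gram cB) // si; have := of_trans fB ir kr jr hi kj.
by move/gtr0_norm=> ->; ring.
Qed.

(** The Gram values at [r] are signed entries of [B]; they become absolute values because [r] is a
    source among the in-neighbours of [k]. *)
Lemma gram_moved2 i j : i != k -> j != k -> i != j -> 0 < B i k -> 0 < B j k ->
  form A (row i C) (row j C) = - `|B i j|.
Proof.
have skew := of_skew fB.
have sgn x : x != r -> 0 < B x k -> s x = 1.
  by move=> xr hx; rewrite (co_sorted cB xr kr) // sk mulr1.
move=> ik jk ij hi hj; have [ir|ir] := eqVneq i r.
  have jr : j != r by rewrite -ir eq_sym.
  rewrite ir in hi *; rewrite (co_gramr cB) // sgn // mulN1r.
  by rewrite (gtr0_norm (return_source fB jr hi hj)).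
have [jr|jr] := eqVneq j r; last by rewrite (co_gram cB) // !sgn //; ring.
rewrite jr in hj *; rewrite formC // (co_gramr cB) // sgn // mulN1r.
have h := return_source fB ir hj hi.
by rewrite (skew i r) normrN gtr0_norm.
Qed.

(** Dually, an out-neighbour [r] of [k] is a sink among them and has sign -1, which again yields the
    absolute value. *)
Lemma gram_fixed2 i j :
  i != k -> j != k -> i != j -> B i k <= 0 -> B j k <= 0 ->
  form A (row i C) (row j C) = - s i * s j * `|B i j|.
Proof.
have skew := of_skew fB.
have out x : x != k -> B x k <= 0 -> 0 < B k x.
  by move=> xk; have := arrow_total fB xk; have := skew k x; lia.
move=> ik jk ij hi hj; have oi := out i ik hi; have oj := out j jk hj.
have [ir|ir] := eqVneq i r.
  have jr : j != r by rewrite -ir eq_sym.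
  rewrite ir in hi oi *; rewrite (co_gramr cB) // sign_return //.
  have h := return_sink fB jr oi oj.
  by rewrite (skew r j) normrN gtr0_norm //; ring.
have [jr|jr] := eqVneq j r; last by rewrite (co_gram cB).
rewrite jr in hj oj *; rewrite formC // (co_gramr cB) // sign_return //.
have h := return_sink fB ir oj oi.
by rewrite gtr0_norm // (skew i r); ring.
Qed.

(** By abundance a moved row gains at least two copies of [row k C]. Only the row of [r] can be
    negative beforehand, and domination by [k] lets it use up at most one copy. *)
Lemma step_pos_dominating i :
  i != k -> dominating (mutB B k) (mutC B C k) (mut_sign B s k) k i.
Proof.
have signk : mut_sign B s k k = -1 by rewrite /mut_sign eqxx sk.
move=> ik; rewrite /dominating (mutB_l B) signk.
have skew := of_skew fB k i; move=> h.
have hi : 0 < B i k by lia.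
rewrite sign_moved // opprK; split=> // m.
have /rowP/(_ m) := row_mutC_moved ik hi; rewrite !mxE => ->.
have := ge0_k m; rewrite eqxx.
have i2 : 2 <= B i k by have := arrow_total fB ik; lia.
have [ir|ir] := eqVneq i r; last first.
  have si : s i = 1 by rewrite (co_sorted cB ir kr) // sk mulr1.
  by have := co_ge0 cB i m; rewrite si; nia.
rewrite ir in hi i2 *; have [sr|sr] := co_sign cB r.
  by have := co_ge0 cB r m; rewrite sr; nia.
have [|_ /(_ m)] := dk; first by rewrite sr; lia.
by rewrite sr sk; nia.
Qed.

Lemma step_pos : coherent A (mutB B k) (mutC B C k) (mut_sign B s k) k.
Proof.
have fB' := ordered_fork_mut fB kr; have skew := of_skew fB.
have out x : x != k -> B x k <= 0 -> 0 < B k x.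
  by move=> xk; have := arrow_total fB xk; have := skew k x; lia.
have signk : mut_sign B s k k = -1 by rewrite /mut_sign eqxx sk.
have gk2 := co_gram2 cB k.
split.
- move=> i; rewrite /mut_sign sk.
  case: ifP => _; first by right.
  by case: ifP => _; [left|exact: co_sign cB i].
- move=> i j ik jk.
  have [hi|hi] := ltP 0 (B i k); have [hj|hj] := ltP 0 (B j k).
  + by rewrite !sign_moved.
  + rewrite (sign_moved ik hi) (sign_fixed jk hj).
    have := mutB_return fB kr hi (out j jk hj).
    by case: (co_sign cB j) => ->; lia.
  + rewrite (sign_moved jk hj) mulr1 (mutB_skew _ fB) //.
    by have := mutB_return fB kr hj (out i ik hi); lia.
  + have oi := out i ik hi; have oj := out j jk hj.
    rewrite !sign_fixed // (mutB_same fB) //; last by lia.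
    have [ir|ir] := eqVneq i r.
      rewrite ir in ik hi oi *; have [->//|jr] := eqVneq j r.
      have := return_sink fB jr oi oj; have := skew r j.
      by rewrite sign_return //; case: (co_sign cB j) => ->; lia.
    have [jr|jr] := eqVneq j r; last exact: (co_sorted cB).
    rewrite jr in jk hj oj *.
    have := return_sink fB ir oj oi.
    by rewrite sign_return //; lia.
- move=> i m; have [->|ik] := eqVneq i k.
    rewrite signk; have /rowP/(_ m) := row_mutC_k; rewrite !mxE => ->.
    by have := ge0_k m; lia.
  have [hi|hi] := ltP 0 (B i k); last first.
    rewrite sign_fixed //; have /rowP/(_ m) := row_mutC_fixed ik hi.
    by rewrite ![row _ _ _ _]mxE => ->; exact: co_ge0 cB i m.
  (* A moved row is nonnegative because it is bounded below by the nonnegative [row k C]. *)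
  have [|e] := step_pos_dominating ik.
    by rewrite signk (mutB_l B) (skew k i); lia.
  move/(_ m); apply: le_trans; rewrite signk.
  have /rowP/(_ m) := row_mutC_k; rewrite ![row _ _ _ _]mxE mxE => ->.
  by rewrite !mxE; have := ge0_k m; lia.
- move=> i; have [->|ik] := eqVneq i k.
    by rewrite row_mutC_k formNl formNr opprK.
  have [hi|hi] := ltP 0 (B i k); last first.
    by rewrite row_mutC_fixed // (co_gram2 cB).
  rewrite row_mutC_moved // !(formDl, formDr, formZl, formZr) (co_gram2 cB).
  rewrite gk2 (formC (row k C)) // gram_moved ?sk ?mulr1 // gtr0_norm //.
  by ring.
- move=> i j ik jk ij.
  have mixed x y : x != k -> y != k -> 0 < B x k -> B y k <= 0 ->
      form A (row x (mutC B C k)) (row y (mutC B C k)) =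
      - mut_sign B s k x * mut_sign B s k y * `|mutB B k x y|.
    move=> xk yk hx hy; have oy := out y yk hy.
    rewrite gtr0_norm; last by have := mutB_return fB kr hx oy; lia.
    rewrite (mutB_through fB) // (sign_moved xk hx) (sign_fixed yk hy).
    rewrite (row_mutC_moved xk hx) (row_mutC_fixed yk hy) formDl formZl.
    rewrite gram_mixed //.
    by rewrite (formC (row k C)) // gram_fixed //; ring.
  have [hi|hi] := ltP 0 (B i k); have [hj|hj] := ltP 0 (B j k).
  + rewrite !row_mutC_moved // !(formDl, formDr, formZl, formZr) gk2.
    rewrite (formC (row k C)) // !gram_moved ?sk ?mulr1 //.
    rewrite (gtr0_norm hi) (gtr0_norm hj).
    rewrite gram_moved2 // !sign_moved // (mutB_same fB) //; last by lia.
    by ring.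
  + exact: mixed.
  + rewrite formC // (mixed j i) // (mutB_skew k fB i j) normrN; ring.
  + rewrite !row_mutC_fixed // !sign_fixed // (mutB_same fB) //; last by lia.
    exact: gram_fixed2.
- move=> i ik; rewrite row_mutC_k formNl (mutB_l B) formC //.
  have [hi|hi] := ltP 0 (B i k).
    rewrite row_mutC_moved // formDl formZl gk2 gram_moved ?sk ?mulr1 //.
    by rewrite sign_moved // gtr0_norm // (skew k i); ring.
  by rewrite row_mutC_fixed // sign_fixed // gram_fixed //; ring.
Qed.
End PositiveStep.
End Step.

(** * Mutation of l-vectors by reflections *)

(** The group preserves the form of [A], so [g s_k g^-1] acts as the reflection in [x = g(alpha_k)].
    Conjugating the element of [i] by it multiplies the conjugator of [i], and hence reflects
    [y]. *)
Lemma lvector_rcons_moved n (A B : 'M[int]_n) w k i x y :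
  A^T = A -> (forall j, A j j = 2) ->
  vpos (Bmat B w i k *: cvec B w k) ->
  lvector A B w k x -> lvector A B w i y ->
  lvector A B (rcons w k) i (y - form A y x *: x).
Proof.
move=> symA A2 v [g Hg ->] [h Hh ->]; exists (conjW g k ++ h).
  rewrite refl_rcons v {1}/conjW rev_cat conjW_rev.
  have -> : (conjW g k ++ h) ++ [:: i] ++ rev h ++ conjW g k
          = conjW g k ++ conjW h i ++ conjW g k by rewrite /conjW -!catA.
  by apply: eqW_cat => //; apply: eqW_cat.
have form_gen j u u' : form A (act_gen A j u) (act_gen A j u') = form A u u'.
  rewrite /act_gen -!form_alphar -!scaleNr !(formDl, formDr, formZl, formZr).
  by rewrite form_alpha A2 (formC (alpha j)) //; ring.
have form_act g' u u' : form A (act A g' u) (act A g' u') = form A u u'.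
  by elim: g' => //= j g' IH; rewrite form_gen IH.
have actB g' u u' : act A g' (u - u') = act A g' u - act A g' u'.
  elim: g' => //= j g' ->; rewrite /act_gen -!form_alphar formDl formNl.
  by apply/rowP=> m; rewrite !mxE; ring.
set z := act A h _; rewrite act_cat -/z /conjW !act_cat /= /act_gen.
have gK u : act A g (act A (rev g) u) = u by rewrite -{1}(revK g) act_revK.
rewrite -form_alphar actB actZ gK.
by rewrite -(form_act g (act A (rev g) z)) gK.
Qed.

(** Identifies the test in the definition of [refl] with the condition under which [row_mutC] moves
    a row. *)
Lemma vposZ n (c : 'rV[int]_n) (b s : int) :
  s = 1 \/ s = -1 -> (forall m, 0 <= s * c 0 m) -> c != 0 ->
  vpos (b *: c) = (0 < b * s).
Proof.
move=> s1 c0 nz; apply/idP/idP.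
  case/andP=> /rV0Pn[m]; rewrite mxE => nzm /forallP/(_ m); rewrite mxE => bc.
  have {nzm bc} : 0 < b * c 0 m by rewrite lt_neqAle eq_sym nzm.
  by have := c0 m; case: s1 => ->; rewrite ?mul1r ?mulN1r; nia.
move=> bs; apply/andP; split.
  have [m cm] := rV0Pn _ nz; apply/rV0Pn; exists m; rewrite mxE mulf_neq0 //.
  by apply/eqP=> b0; rewrite b0 mul0r in bs.
apply/forallP=> m; rewrite mxE.
have -> : b * c 0 m = (b * s) * (s * c 0 m) by case: s1 => ->; ring.
exact: mulr_ge0 (ltW bs) (c0 m).
Qed.

Lemma lvector_rcons n (A B D : 'M[int]_n) w k (s : int) :
  A^T = A -> (forall j, A j j = 2) -> Bmat B w k k = 0 ->
  s = 1 \/ s = -1 -> (forall m, 0 <= s * cvec B w k 0 m) -> cvec B w k != 0 ->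
  (forall i, 0 < Bmat B w i k * s ->
     form A (cvec B w i *m D) (cvec B w k *m D) = - `|Bmat B w i k|) ->
  (forall i, lvector A B w i (cvec B w i *m D)) ->
  forall i, lvector A B (rcons w k) i (cvec B (rcons w k) i *m D).
Proof.
move=> symA A2 Bkk s1 c0 nz gr lw i.
have fixed l : ~~ vpos (Bmat B w i k *: cvec B w k) ->
    lvector A B w i l -> lvector A B (rcons w k) i l.
  by move=> /negPf v; rewrite /lvector refl_rcons v.
have [ik|ik] := eqVneq i k.
  have -> : cvec B (rcons w k) i = - cvec B w i.
    by apply/rowP=> m; rewrite /cvec Cmat_rcons !mxE ik eqxx.
  apply: fixed; first by rewrite ik Bkk scale0r /vpos eqxx.
  by rewrite mulNmx; apply/(lvector_uniq A2 _ (lw i)); right.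
have -> : cvec B (rcons w k) i = cvec B w i +
    (if 0 < Bmat B w i k * s then `|Bmat B w i k| else 0) *: cvec B w k.
  rewrite /cvec Cmat_rcons; apply: row_mutC => // m.
  by have := c0 m; rewrite mxE.
have v := vposZ (Bmat B w i k) s1 c0 nz.
case: ifP => hi; last by rewrite scale0r addr0; apply: fixed; rewrite ?v ?hi.
rewrite mulmxDl -scalemxAl -[_ *: _]opprK -scaleNr -gr //.
by apply: lvector_rcons_moved; rewrite ?v.
Qed.

(** * Preservation of the invariants, and the first mutation *)

Section Evolution.
Variable n : nat.
Implicit Types (A B C D : 'M[int]_n) (s : 'I_n -> int) (i j k l m r : 'I_n).

Definition state A B C s r :=
  [/\ ordered_fork B r, coherent A B C s r &
      forall i, i != r -> dominating B C s r i].

(** Domination is asked at [k] alone, so that the first mutation is covered as well. The signs are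
    given pointwise because the negative case produces them by a double negation. *)
Lemma step A B C s r k : A^T = A -> ordered_fork B r -> coherent A B C s r ->
  k != r -> dominating B C s r k ->
  exists2 s', s' =1 mut_sign B s k & state A (mutB B k) (mutC B C k) s' k.
Proof.
move=> symA fB cB kr dk; have fB' := ordered_fork_mut fB kr.
have [sk|sk] := co_sign cB k.
  exists (mut_sign B s k) => //; split=> //.
    exact: step_pos fB cB kr dk symA sk.
  by move=> i; exact: step_pos_dominating fB cB kr dk sk i.
have fN := ordered_forkN fB; have cN := coherentN cB; have dN := dominatingN dk.
have skN : - s k = 1 by rewrite sk opprK.
exists (fun i => - mut_sign (- B) (fun i => - s i) k i).
  move=> i; rewrite /mut_sign; case: ifP => _; first by rewrite opprK.
  by rewrite mxE mulrNN; case: ifP => _; rewrite opprK.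
split=> //.
  have := coherentN (step_pos fN cN kr dN symA skN).
  by rewrite mutBN mutCN !opprK.
move=> i ik.
have := dominatingN (step_pos_dominating fN cN kr dN skN ik).
by rewrite mutBN mutCN !opprK.
Qed.

Definition flip_sign r i : int := if i == r then -1 else 1.
Definition flip r : 'M[int]_n := diag_mx (\row_j flip_sign r j).

Lemma flip_sign_sq r i : flip_sign r i * flip_sign r i = 1.
Proof. by rewrite /flip_sign; case: ifP. Qed.

Lemma flipE r C i m : (flip r *m C) i m = flip_sign r i * C i m.
Proof. by rewrite /flip mul_diag_mx !mxE. Qed.

Lemma flipK r : flip r *m flip r = 1%:M.
Proof.
apply/matrixP=> i j; rewrite flipE !mxE; have [->|_] := eqVneq i j.
  exact: flip_sign_sq.
by rewrite mulr0n mulr0.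
Qed.

Lemma flip_conjE r A i j :
  (flip r *m A *m (flip r)^T) i j = flip_sign r i * flip_sign r j * A i j.
Proof.
by rewrite {2}/flip tr_diag_mx mul_mx_diag mxE flipE mxE; ring.
Qed.

Lemma row_flip r C i : row i (flip r *m C) = flip_sign r i *: row i C.
Proof. by apply/rowP=> m; rewrite ![(row _ _) _ _]mxE flipE !mxE. Qed.

(** The Gram conditions survive when a row is negated together with its sign. All signs off [k]
    become 1, and [B k r <= 0] makes the domination condition at [r] vacuous. *)
Lemma state_flip A B C s r k : state A B C s k -> r != k ->
  s k = -1 -> s r = -1 -> (forall i, i != k -> i != r -> s i = 1) ->
  B k r <= 0 ->
  state A B (flip r *m C) (fun i => flip_sign r i * s i) k.
Proof.
case=> fB [s1 so p g2 g gr] d rk sk sr si kr.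
have s'1 i : i != k -> flip_sign r i * s i = 1.
  rewrite /flip_sign; have [->|ir] := eqVneq i r; first by rewrite sr.
  by move=> ik; rewrite si.
have s'k : flip_sign r k * s k = s k.
  by rewrite /flip_sign eq_sym (negPf rk) mul1r.
split=> //; first split.
- move=> i; have [->|ik] := eqVneq i k; first by rewrite s'k.
  by left; rewrite s'1.
- by move=> i j ik jk _; rewrite !s'1.
- by move=> i m; rewrite flipE mulrACA flip_sign_sq mul1r.
- by move=> i; rewrite row_flip formZl formZr g2 mulrA flip_sign_sq mul1r.
- by move=> i j ik jk ij; rewrite !row_flip formZl formZr g //; ring.
- move=> i ik; rewrite !row_flip formZl formZr gr // {1}/flip_sign.
  by rewrite eq_sym (negPf rk); ring.
move=> i ik; rewrite /dominating s'k => h.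
have ir : i != r by apply/eqP=> e; rewrite e sk in h; lia.
have [-> hm] := d i ik h; rewrite /flip_sign (negPf ir) mul1r; split=> // m.
rewrite !flipE /flip_sign (negPf ir) eq_sym (negPf rk) !mul1r.
exact: hm.
Qed.

Lemma form_conj A D x y :
  form (D *m A *m D^T) x y = form A (x *m D) (y *m D).
Proof. by rewrite /form trmx_mul !mulmxA. Qed.

Definition first_sign B r k : 'M[int]_n := if 0 < B r k then flip r else 1%:M.

Lemma state_first A B r k : ordered_fork B r -> k != r -> A^T = A ->
  (forall i, A i i = 2) ->
  (forall i j, i != r -> j != r -> i != j -> A i j = - `|B i j|) ->
  (forall i, i != r -> A r i = B r i) ->
  let D := first_sign B r k in
  exists s, state (D *m A *m D^T) (mutB B k) (mutC B 1%:M k) s k.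
Proof.
move=> fB kr symA A2 Aij Ar /=; rewrite /first_sign.
have row1E i : row i (1%:M : 'M[int]_n) = alpha i by exact: row1.
have symF : (flip r *m A *m (flip r)^T)^T = flip r *m A *m (flip r)^T.
  by rewrite !trmx_mul trmxK symA mulmxA.
have fs i : i != r -> flip_sign r i = 1 by rewrite /flip_sign => /negPf->.
have fsr : flip_sign r r = -1 by rewrite /flip_sign eqxx.
case: ifP => rk.
  (* With all signs 1, [co_gramr] asks for [- B r i] where the GIM has [B r i]; conjugation by
     [flip r] corrects this. Domination at [k] is vacuous since [r -> k]. *)
  have c0 : coherent (flip r *m A *m (flip r)^T) B 1%:M (fun _ => 1) r.
    split=> //; first by left.
    - by move=> i m; rewrite mul1r !mxE; case: eqP.
    - by move=> i; rewrite row1E form_alpha flip_conjE A2 flip_sign_sq.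
    - move=> i j ir jr ij; rewrite !row1E form_alpha flip_conjE !fs // Aij //.
      by ring.
    - move=> i ir; rewrite !row1E form_alpha flip_conjE fsr fs // Ar //; ring.
  have [|s _ st] := step symF fB c0 kr _; first by move=> h; lia.
  by exists s.
rewrite trmx1 mulmx1 mul1mx.
(* The first mutation leaves the row of [r] alone, but the Gram matrix is that
   of a negative [r]: negate this row before the mutation, and back after it. *)
have rk' : B r k < 0 by have := arrow_total fB kr; have := of_skew fB k r; lia.
have c0 : coherent A B (flip r *m 1%:M) (flip_sign r) r.
  split.
  - by move=> i; rewrite /flip_sign; case: ifP; [right|left].
  - by move=> i j ir jr _; rewrite !fs.
  - by move=> i m; rewrite flipE mulrA flip_sign_sq mul1r mxE; case: eqP.
  - move=> i; rewrite row_flip row1E formZl formZr form_alpha A2.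
    by rewrite mulrA flip_sign_sq.
  - move=> i j ir jr ij; rewrite !row_flip !row1E formZl formZr form_alpha.
    by rewrite !fs // Aij //; ring.
  - move=> i ir; rewrite !row_flip !row1E formZl formZr form_alpha fsr fs //.
    by rewrite Ar //; ring.
have [|s es st] := step symA fB c0 kr _.
  by rewrite /dominating fsr; lia.
have rk0 : r != k by rewrite eq_sym.
exists (fun i => flip_sign r i * s i).
(* The two flips cancel: as [B r k < 0] and row [k] is a unit vector, row [r] is not moved. *)
have -> : mutC B 1%:M k = flip r *m mutC B (flip r *m 1%:M) k.
  apply/matrixP=> i m; rewrite flipE ![mutC _ _ _ _ _]mxE !flipE.
  rewrite (fs k) // mul1r ![1%:M _ _]mxE.
  have [->|ir] := eqVneq i r; last by rewrite fs // !mul1r.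
  rewrite fsr (negPf rk0) mulN1r mulN1r opprD opprK; congr (_ + _).
  rewrite !sgr_max_mul; case: (k == m); rewrite ?mulr0 ?mulr1 ?ltxx ?oppr0 //.
  by rewrite ltNge ltW //= oppr0.
have skk : s k = -1 by rewrite es /mut_sign eqxx fs.
apply: state_flip => //.
- rewrite es /mut_sign (negPf rk0) (fs k) // mulr1 fsr.
  by rewrite ltNge ltW.
- move=> i ik ir; rewrite es /mut_sign (negPf ik) (fs k) // fs //.
  by case: ifP.
- by rewrite (mutB_l B) (of_skew fB k r) opprK ltW.
Qed.
End Evolution.

(** * The GIM of a fork, and induction along the mutation sequence *)

Section Gim.
Variables (n : nat) (B : 'M[int]_n) (r : 'I_n) (a : seq 'I_n).
Hypotheses (hB : fork B r) (ha : acyclic_listing B r a).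

Let A := gim B (list_order (r :: rev a)).

Lemma fork_skew i j : B i j = - B j i.
Proof. by case: hB => /matrixP/(_ j i); rewrite !mxE. Qed.

Lemma listing_mem i : i != r -> i \in a.
Proof.
move=> ir; case: ha => /perm_mem/(_ i); rewrite mem_enum inE (negPf ir) /=.
by move=> ->.
Qed.

Lemma listing_uniq : uniq a.
Proof.
case: ha => /perm_uniq; rewrite enum_uniq => u _.
by move: u => /= /andP[].
Qed.

(** Abundance provides an arrow between [i] and [l], and the listing decides its direction. *)
Lemma fork_ordered : ordered_fork B r.
Proof.
case: (hB) => _ ab _ ret _; case: ha => _ lst; split.
- exact: fork_skew.
- exact: ab.
- move=> i j l ir jr lr hij hjl.
  have ij := lst i j (listing_mem ir) (listing_mem jr) hij.
  have jl := lst j l (listing_mem jr) (listing_mem lr) hjl.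
  have il := ltn_trans ij jl.
  have nil : i != l by apply/eqP=> e; rewrite e ltnn in il.
  have [//|h] := ltP 0 (B i l).
  have li : arrow B l i.
    by rewrite /arrow; have := ab i l nil; have := fork_skew i l; lia.
  by have := lst l i (listing_mem lr) (listing_mem ir) li; lia.
- by move=> i j hi hj; apply: ret; rewrite inE.
Qed.

Lemma list_order_rev (i j : 'I_n) : i != r -> j != r ->
  list_order (r :: rev a) i j = (index j a < index i a)%N.
Proof.
move=> ir jr; rewrite /list_order /= ![r == _]eq_sym (negPf ir) (negPf jr).
have idx (x : 'I_n) : x != r -> (index x (rev a) + index x a).+1 = size a.
  move=> xr; have xa := listing_mem xr.
  have sx : (index x a < size a)%N by rewrite index_mem.
  have -> : index x (rev a) = (size a - (index x a).+1)%N.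
    rewrite -{1}(nth_index x xa).
    have -> : nth x a (index x a) = nth x (rev a) (size a - (index x a).+1).
      by rewrite nth_rev; [congr nth; lia|lia].
    rewrite index_uniq ?rev_uniq ?listing_uniq // size_rev ltn_subrL /=.
    exact: leq_ltn_trans sx.
  lia.
have := idx i ir; have := idx j jr; lia.
Qed.

(** The order reverses the listing, so [i] precedes [j] exactly when the arrows go from [j] to [i];
    both cases of the definition are then negative. *)
Lemma gim_off i j : i != r -> j != r -> i != j -> A i j = - `|B i j|.
Proof.
move=> ir jr ij; rewrite mxE (negPf ij) list_order_rev //.
have [_ lst] := ha; have lij := lst i j (listing_mem ir) (listing_mem jr).
have lji := lst j i (listing_mem jr) (listing_mem ir).
have := arrow_total fork_ordered ij; have := fork_skew i j.
by rewrite /arrow in lij lji *; case: ifP; lia.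
Qed.

Lemma gim_return i : i != r -> A r i = B r i.
Proof.
move=> ir; rewrite mxE eq_sym (negPf ir) /list_order /= eqxx.
by rewrite eq_sym (negPf ir).
Qed.

Lemma gim_sym : A^T = A.
Proof.
apply/matrixP=> i j; rewrite mxE; have [->//|ij] := eqVneq i j.
have [ir|ir] := eqVneq i r; last have [jr|jr] := eqVneq j r.
- rewrite ir in ij *; rewrite gim_return 1?eq_sym // mxE eq_sym (negPf ij).
  by rewrite /list_order /= eqxx ltn0 -fork_skew.
- rewrite jr in ij *; rewrite gim_return // mxE (negPf ij).
  by rewrite /list_order /= eqxx ltn0 -fork_skew.
- by rewrite !gim_off // 1?eq_sym // fork_skew normrN.
Qed.

(** The point of return is always the last mutated vertex, so reducedness says that the next
    mutation avoids it. The matrix [D] is absorbed into [A] by [form_conj]. *)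
Lemma state_lvector k w : k != r -> reduced (k :: w) ->
  let D := first_sign B r k in
  exists2 s, state (D *m A *m D^T) (Bmat B (k :: w)) (Cmat B (k :: w)) s
                   (last k w) &
    forall i, lvector A B (k :: w) i (cvec B (k :: w) i *m D).
Proof.
move=> kr red D; have fB := fork_ordered; have symA := gim_sym.
have A2 i : A i i = 2 by exact: gim_diag.
elim/last_ind: w red => [_|w k' IH].
  have [s st] := state_first fB kr symA A2 gim_off gim_return.
  have nilE : [:: k] = rcons [::] k by [].
  exists s; first by rewrite nilE Bmat_rcons Cmat_rcons Bmat_nil Cmat_nil.
  have c0 i : cvec B [::] i = alpha i by rewrite /cvec Cmat_nil; exact: row1.
  rewrite nilE; apply: (lvector_rcons (s := 1)) => //; rewrite ?Bmat_nil ?c0.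
  - exact: skew_diag fB k.
  - by left.
  - by move=> m; rewrite mul1r !mxE; case: (_ && _).
  - by apply/rV0Pn; exists k; rewrite mxE !eqxx.
  - move=> i; rewrite mulr1 !c0 -form_conj form_alpha => hi.
    have ik : i != k by apply/eqP=> e; rewrite e (skew_diag fB) in hi.
    (* If [r] itself is moved then [r -> k], so [D] is the flip and turns the entry [B r k] of the
       GIM into [- B r k]. *)
    rewrite /D /first_sign; have [ir|ir] := eqVneq i r.
      rewrite ir in hi *; rewrite hi flip_conjE /flip_sign eqxx (negPf kr).
      by rewrite gim_return // (gtr0_norm hi); ring.
    case: ifP => _; last by rewrite trmx1 mulmx1 mul1mx gim_off.
    by rewrite flip_conjE /flip_sign (negPf kr) (negPf ir) gim_off //; ring.
  - move=> i; rewrite c0.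
    have l0 : lvector A B [::] i (alpha i).
      by exists [::]; first exact: eqW_refl.
    apply/(lvector_uniq A2 _ l0); rewrite /D /first_sign.
    case: ifP => _; last by left; rewrite mulmx1.
    have -> : alpha i *m flip r = flip_sign r i *: alpha i.
      by rewrite /alpha -rowE -[flip r]mulmx1 row_flip row1.
    rewrite /flip_sign; case: ifP => _; first by right; rewrite scaleN1r.
    by left; rewrite scale1r.
rewrite /reduced /= rcons_path => /andP[red lk].
have [s [fw cw dw] lw] := IH red.
have k'l : k' != last k w by rewrite eq_sym.
have symD : (D *m A *m D^T)^T = D *m A *m D^T.
  by rewrite !trmx_mul trmxK symA mulmxA.
have [s' _ st] := step symD fw cw k'l (dw k' k'l).
rewrite last_rcons -rcons_cons; exists s'.
  by rewrite Bmat_rcons Cmat_rcons.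
apply: (lvector_rcons (s := s k')) => //.
- exact: skew_diag fw k'.
- exact: co_sign cw k'.
- by move=> m; rewrite [cvec _ _ _ _ _]mxE; exact: co_ge0 cw k' m.
(* The c-vector is nonzero because its norm is 2. *)
- apply/eqP=> c0; have := co_gram2 cw k'; rewrite -/(cvec B (k :: w) k') c0.
  by rewrite /form !mul0mx mxE.
- by move=> i hi; rewrite -form_conj; apply: gram_moved fw cw k'l _ hi.
Qed.
End Gim.

Theorem theorem1p13 (n : nat) (B : 'M[int]_n) (r : 'I_n) (a w : seq 'I_n)
    (hB : fork B r) (ha : acyclic_listing B r a) (hw : fork_preserving r w)
    (i : 'I_n) :
  exists D : 'M[int]_n,
    [/\ is_diag_mx D, D *m D = 1%:M
      & forall l : 'rV[int]_n,
          lvector (gim B (list_order (r :: rev a))) B w i l <->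
          eq_upto_sign l (cvec B w i *m D)].
Proof.
have A2 j : gim B (list_order (r :: rev a)) j j = 2 by exact: gim_diag.
case: w hw => [_|k w /andP[red /= kr]].
  exists 1%:M; split; [exact: scalar_mx_is_diag|exact: mulmx1|move=> l].
  rewrite mulmx1; apply: lvector_uniq => //; exists [::]; first exact: eqW_refl.
  by rewrite /cvec Cmat_nil; exact: row1.
have kr' : k != r by apply: contra kr => /eqP->.
have [s _ lw] := state_lvector hB ha kr' red.
exists (first_sign B r k); split; last by move=> l; apply: lvector_uniq.
  rewrite /first_sign; case: ifP => _; first exact: diag_mx_is_diag.
  exact: scalar_mx_is_diag.
by rewrite /first_sign; case: ifP => _; [exact: flipK|exact: mulmx1].
Qed.
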